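(* Let $(G,\cdot)$ be a homogeneous group given by a homogeneous presentation $\mathcal{P} = \langle \mathcal{A} \mid \mathcal{R} \rangle$, and let $l : G \to \mathbb{Z}$ be the associated logarithm. Let $\varphi \in \operatorname{Aut}(G,\cdot)$ be such that $l(\varphi(g)) = 1$ for all $g \in \mathcal{A}$. Then the set $$H_{\lambda} = \{ (\varphi^{l(w)}, w) \mid w \in G \}$$ is a regular subgroup of $\operatorname{Hol}(G,\cdot)$.
   Context: Let $\mathcal{P} = \langle \mathcal{A} \mid \mathcal{R} \rangle$ be a presentation of a group with generators $\mathcal{A} = \{g_1, g_2, \dots\}$ and relators $\mathcal{R} = \{r_1, r_2, \dots\}$. For a word $w = g_{i_1}^{\alpha_1} g_{i_2}^{\alpha_2} \cdots g_{i_s}^{\alpha_s}$ with $g_{i_j} \in \mathcal{A}$, $\alpha_j \in \mathbb{Z}$, the logarithm of $w$ is $l(w) = \sum_{j=1}^s \alpha_j$. The presentation is homogeneous if $l(r) = 0$ for all $r \in \mathcal{R}$; a group is homogeneous if it admits a homogeneous presentation. For a group given by a homogeneous presentation, $l$ is a well-defined function $l: G \to \mathbb{Z}$. The holomorph $\operatorname{Hol} G = \operatorname{Aut} G \ltimes G$ is the set of pairs $(f,a)$ with $f \in \operatorname{Aut} G$, $a \in G$, with product $(f,a)(g,b) = (fg, a f(b))$. A subgroup $H \le \operatorname{Hol} G$ is regular if for each $a \in G$ there is a unique $(f,x) \in H$ with $x f(a) = 1$ (equivalently, the action of $H$ on $G$ by $(f,a)\cdot b = a f(b)$ is free and transitive).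 *)

(* Defs.v *)
From HB Require Import structures.
From mathcomp Require Import all_boot all_order all_algebra.
From mathcomp Require Import boolp classical_sets.

Set Implicit Arguments.
Unset Strict Implicit.
Unset Printing Implicit Defensive.

Local Open Scope classical_set_scope.
Local Open Scope group_scope.

Definition expgz (G : groupType) (x : G) (n : int) : G :=
  match n with
  | Posz k => x ^+ k
  | Negz k => x ^- k.+1
  end.

(* The word g_1^{n_1} ... g_s^{n_s} is the list (g_1, n_1), ..., (g_s, n_s). *)
Definition word (A : Type) := seq (A * int).

Definition word_log (A : Type) (w : word A) : int :=
  (\sum_(p <- w) p.2)%R.

Definition word_eval (G : groupType) (A : Type) (gen : A -> G) (w : word A) : G :=
  \prod_(p <- w) expgz (gen p.1) p.2.

(* Equality of words in the group < A | R >: the least congruence for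
   concatenation containing the free-group identities and r = 1 for r in R. *)
Inductive pres_eq (A : Type) (R : set (word A)) : word A -> word A -> Prop :=
  | pres_refl u : pres_eq R u u
  | pres_sym u v : pres_eq R u v -> pres_eq R v u
  | pres_trans u v w : pres_eq R u v -> pres_eq R v w -> pres_eq R u w
  | pres_cat u u' v v' :
      pres_eq R u u' -> pres_eq R v v' -> pres_eq R (u ++ v) (u' ++ v')
  | pres_exp0 a : pres_eq R [:: (a, 0%R)] [::]
  | pres_expD a m n :
      pres_eq R [:: (a, m); (a, n)] [:: (a, (m + n)%R)]
  | pres_relator r : R r -> pres_eq R r [::].

(* word_eval gen induces an isomorphism from < A | R > onto G. *)
Definition presentation (G : groupType) (A : Type) (gen : A -> G)
    (R : set (word A)) : Prop :=
  (forall g : G, exists w, word_eval gen w = g) /\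
  (forall u v, word_eval gen u = word_eval gen v <-> pres_eq R u v).

Definition homogeneous (A : Type) (R : set (word A)) : Prop :=
  forall r, R r -> word_log r = 0%R.

(* The logarithm of any word representing g; word-independent for a homogeneous
   presentation (see logarithm_eval). *)
Definition logarithm (G : groupType) (A : Type) (gen : A -> G) (g : G) : int :=
  xget 0%R [set word_log w | w in [set w | word_eval gen w = g]].

Lemma pres_eq_log (A : Type) (R : set (word A)) (u v : word A) :
  homogeneous R -> pres_eq R u v -> word_log u = word_log v.
Proof.
move=> hR; rewrite /word_log; elim=> {u v} //=.
- by move=> u v w _ -> _ ->.
- by move=> u u' v v' _ uu' _ vv'; rewrite !big_cat /= uu' vv'.
- by move=> a; rewrite big_seq1 big_nil.
- by move=> a m n; rewrite big_cons !big_seq1.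
- by move=> r /hR; rewrite big_nil.
Qed.

Lemma logarithm_eval (G : groupType) (A : Type) (gen : A -> G)
    (R : set (word A)) (w : word A) :
  presentation gen R -> homogeneous R ->
  logarithm gen (word_eval gen w) = word_log w.
Proof.
move=> [_ prR] hR; apply: xget_unique; first by exists w.
by move=> _ [v /= /prR vw <-]; apply: pres_eq_log vw.
Qed.

Record aut (G : groupType) := Aut {
  aut_fun :> G -> G;
  aut_inv : G -> G;
  aut_funK : cancel aut_fun aut_inv;
  aut_invK : cancel aut_inv aut_fun;
  aut_morph : {morph aut_fun : x y / x * y} }.

Lemma autP (G : groupType) (f g : aut G) : f =1 g -> f = g.
Proof.
case: f g => [f f' fK f'K fM] [g g' gK g'K gM] /= /funext fg; subst g.
have e : f' = g' by apply/funext => x; rewrite -{1}(g'K x) fK.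
by subst g'; congr Aut; apply: Prop_irrelevance.
Qed.

Section AutGroup.
Variable G : groupType.
Implicit Types f g : aut G.

HB.instance Definition _ := gen_eqMixin (aut G).
HB.instance Definition _ := gen_choiceMixin (aut G).

Definition aut1 : aut G :=
  @Aut G idfun idfun (fun=> erefl) (fun=> erefl) (fun _ _ => erefl).

Lemma autM_morph f g : {morph f \o g : x y / x * y}.
Proof. by move=> x y /=; rewrite !aut_morph. Qed.

Definition autM f g : aut G :=
  Aut (can_comp (@aut_funK _ f) (@aut_funK _ g))
      (can_comp (@aut_invK _ g) (@aut_invK _ f)) (autM_morph f g).

Lemma autV_morph f : {morph aut_inv f : x y / x * y}.
Proof.
move=> x y.
by rewrite -{1}(aut_invK f x) -{1}(aut_invK f y) -aut_morph aut_funK.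
Qed.

Definition autV f : aut G :=
  Aut (@aut_invK _ f) (@aut_funK _ f) (@autV_morph f).

Lemma autMA : associative autM. Proof. by move=> f g h; apply: autP. Qed.
Lemma aut1M : left_id aut1 autM. Proof. by move=> f; apply: autP. Qed.
Lemma autM1 : right_id aut1 autM. Proof. by move=> f; apply: autP. Qed.
Lemma autVM : left_inverse aut1 autV autM.
Proof. by move=> f; apply: autP => x /=; rewrite aut_funK. Qed.
Lemma autMV : right_inverse aut1 autV autM.
Proof. by move=> f; apply: autP => x /=; rewrite aut_invK. Qed.

HB.instance Definition _ := isGroup.Build (aut G) autMA aut1M autM1 autVM autMV.
End AutGroup.

Record hol (G : groupType) := Hol { hol_aut : aut G; hol_elt : G }.

Section HolGroup.
Variable G : groupType.
Implicit Types p q : hol G.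

HB.instance Definition _ := gen_eqMixin (hol G).
HB.instance Definition _ := gen_choiceMixin (hol G).

Definition hol1 : hol G := Hol 1 1.

Definition holM p q : hol G :=
  Hol (hol_aut p * hol_aut q) (hol_elt p * hol_aut p (hol_elt q)).

Definition holV p : hol G :=
  Hol (hol_aut p)^-1 ((hol_aut p)^-1 (hol_elt p)^-1).

Lemma aut_1 (f : aut G) : f 1 = 1.
Proof. by apply: (mulgI (f 1)); rewrite -aut_morph !mulg1. Qed.

Lemma holMA : associative holM.
Proof. by move=> p q r; rewrite /holM /= mulgA aut_morph mulgA. Qed.
Lemma hol1M : left_id hol1 holM.
Proof. by case=> f a; rewrite /holM /= !mul1g. Qed.
Lemma holM1 : right_id hol1 holM.
Proof. by case=> f a; rewrite /holM /= aut_1 !mulg1. Qed.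
Lemma holVM : left_inverse hol1 holV holM.
Proof.
case=> f a; congr Hol; first exact: mulVg.
by apply: etrans (esym (aut_morph f^-1 _ _)) _; rewrite mulVg aut_1.
Qed.
Lemma holMV : right_inverse hol1 holV holM.
Proof.
case=> f a; congr Hol; first exact: mulgV.
by rewrite /= [X in a * X](aut_invK f) mulgV.
Qed.

HB.instance Definition _ := isGroup.Build (hol G) holMA hol1M holM1 holVM holMV.
End HolGroup.

Definition regular_subgroup (G : groupType) (H : set (hol G)) : Prop :=
  group_closed [in H] /\
  forall a : G, exists! h : hol G, H h /\ hol_elt h * hol_aut h a = 1.

(* Main.v *)
Require Import Defs.
From mathcomp Require Import all_boot all_order all_algebra.
From mathcomp Require Import boolp classical_sets.

(** The logarithm [l] is a homomorphism to the integers, so [l \o phi = l] as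
    soon as both sides agree on generators, and then every power of [phi]
    preserves [l].  This makes [w |-> phi ^ (l w)] compatible with the product
    of the holomorph.  Regularity holds because [w * phi ^ (l w) a = 1] forces
    [l w = - l a], which determines [w]. *)

Lemma expgz1 (G : groupType) (x : G) : expgz x (Posz 1) = x.
Proof. by []. Qed.

Lemma expgzN (G : groupType) (x : G) (n : int) :
  expgz x (- n)%R = ((expgz x n)^-1)%g.
Proof.
by case: n => [[|n]|n] /=; rewrite ?invg1 ?invgK.
Qed.

Lemma expgzSr (G : groupType) (x : G) (n : int) :
  expgz x (n + 1)%R = (expgz x n * x)%g.
Proof.
case: n => [n|[|n]]; first by rewrite -PoszD addn1 /= expgSr.
- by rewrite /= mulVg.
- have -> : (Negz n.+1 + 1)%R = Negz n.
    by rewrite !NegzE -(addn1 n.+1) PoszD GRing.opprD GRing.subrK.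
  by rewrite /= (expgS x n.+1) invgM mulgVK.
Qed.

Lemma expgzD (G : groupType) (x : G) (m n : int) :
  expgz x (m + n)%R = (expgz x m * expgz x n)%g.
Proof.
elim/int_rect: n => [|n IHn|n IHn]; first by rewrite GRing.addr0 mulg1.
  by rewrite -addn1 PoszD GRing.addrA !expgzSr IHn mulgA.
(* Cancelling a factor [x] on the right turns the exponent [- n.+1] into [- n] on both sides, so
   that [expgzSr] also serves the downward step. *)
apply: (mulIg x); rewrite -expgzSr -mulgA -expgzSr.
by rewrite -addn1 PoszD GRing.opprD GRing.addrA !GRing.subrK.
Qed.

Section IntegerCharacter.
Variables (G : groupType) (l : G -> int).
Hypothesis lM : {morph l : x y / (x * y)%g >-> (x + y)%R}.

Lemma character1 : l 1%g = 0%R.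
Proof. by apply: (@GRing.addrI _ (l 1%g)); rewrite -lM mulg1 GRing.addr0. Qed.

Lemma characterV (x : G) : l x^-1%g = (- l x)%R.
Proof.
by apply: (@GRing.addrI _ (l x)); rewrite -lM mulgV character1 GRing.subrr.
Qed.

Lemma character_expgz (x : G) (n : int) : l (expgz x n) = (l x * n)%R.
Proof.
elim/int_rect: n => [|n IHn|n IHn]; first by rewrite GRing.mulr0 character1.
  by rewrite -addn1 PoszD expgzSr lM IHn GRing.mulrDr GRing.mulr1.
rewrite -addn1 PoszD GRing.opprD expgzD lM IHn expgzN expgz1 characterV.
by rewrite GRing.mulrDr GRing.mulrN1.
Qed.

(** Here [gen] need not generate [G]: the main proof takes [phi \o gen], on whose values [l] is 1,
    and the sum becomes [word_log w]. *)
Lemma character_word_eval (A : Type) (gen : A -> G) (w : word A) :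
  l (word_eval gen w) = (\sum_(p <- w) l (gen p.1) * p.2)%R.
Proof.
rewrite /word_eval (big_morph l lM character1).
by apply: eq_bigr => p _; apply: character_expgz.
Qed.

Lemma character_aut_expgz (phi : aut G) (n : int) (x : G) :
  (forall y, l (phi y) = l y) -> l (expgz phi n x) = l x.
Proof.
(* The point [x] stays general because the last factor of the power acts first: the hypothesis is
   used at [phi x] going up and at the preimage of [x] going down. *)
move=> lphi; elim/int_rect: n x => // n IHn x.
  by rewrite -addn1 PoszD expgzSr [LHS]IHn.
rewrite -addn1 PoszD GRing.opprD expgzD (expgzN _ phi 1) expgz1 [LHS]IHn.
by rewrite -[in RHS](aut_invK phi x) lphi.
Qed.

Lemma regular_character_graph (phi : aut G) :
    (forall x, l (phi x) = l x) ->
  regular_subgroup [set Hol (expgz phi (l w)) w | w in [set: G]]%classic.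
Proof.
move=> lphi.
have lpow n x : l (expgz phi n x) = l x by apply: character_aut_expgz.
split.
  split; first by apply/mem_set; exists 1%g; rewrite ?character1.
  move=> _ _ /set_mem[u _ <-] /set_mem[v _ <-]; apply/mem_set.
  (* The witness is the element part of the quotient of the two pairs; its [l] is [l u - l v], since
     powers of [phi] preserve [l]. *)
  exists (u * expgz phi (l u - l v)%R v^-1)%g => //.
  by rewrite lM lpow characterV expgzD expgzN.
move=> a.
(* The equation forces the element to be the inverse of a power of [phi] at [a]; every such inverse
   has [l] equal to [- l a], which fixes the exponent. *)
exists (Hol (expgz phi (- l a)%R) (expgz phi (- l a)%R a)^-1%g); split.
  split; last exact: mulVg.
  by exists (expgz phi (- l a)%R a)^-1%g; rewrite ?characterV ?lpow.
move=> _ [[w _ <-] /= wa1].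
have lw : l w = (- l a)%R.
  by apply/eqP; rewrite -GRing.addr_eq0 -(lpow (l w) a) -lM wa1 character1.
rewrite -lw; congr Hol.
by apply: (mulIg (expgz phi (l w) a)); rewrite mulVg wa1.
Qed.

End IntegerCharacter.

Lemma aut_expgz (G : groupType) (f : aut G) (x : G) (n : int) :
  f (expgz x n) = expgz (f x) n.
Proof.
have fX k : f (x ^+ k)%g = (f x ^+ k)%g.
  by elim: k => [|k IHk]; rewrite ?aut_1 // !expgS aut_morph IHk.
case: n => [k|k] /=; first exact: fX.
by apply: (mulgI (f (x ^+ k.+1)%g)); rewrite -aut_morph mulgV aut_1 fX mulgV.
Qed.

(** Concatenating words multiplies their values and adds their exponent sums; homogeneity lets any
    representing words be used. *)
Lemma logarithm_morph (G : groupType) (A : Type) (gen : A -> G)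
    (R : set (word A)) :
  presentation gen R -> homogeneous R ->
  {morph logarithm gen : x y / (x * y)%g >-> (x + y)%R}.
Proof.
move=> hpres hhom x y.
have [[u <-] [v <-]] := (hpres.1 x, hpres.1 y).
have -> : (word_eval gen u * word_eval gen v)%g = word_eval gen (u ++ v).
  by rewrite /word_eval big_cat.
by rewrite !(logarithm_eval _ hpres hhom) /word_log big_cat.
Qed.

Theorem theorem3p5 (G : groupType) (A : Type) (gen : A -> G)
    (R : set (word A)) (hpres : presentation gen R) (hhom : homogeneous R)
    (phi : aut G) (hphi : forall a : A, logarithm gen (phi (gen a)) = 1%R) :
  regular_subgroup
    [set Hol (expgz phi (logarithm gen w)) w | w in [set: G]]%classic.
Proof.
have lM := logarithm_morph _ _ _ _ hpres hhom.
apply: (regular_character_graph _ _ lM) => x.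
have [w <-] := hpres.1 x.
(* Applying [phi] to a word keeps the exponents and replaces each generator by its image, of
   logarithm 1. *)
have -> : phi (word_eval gen w) = word_eval (phi \o gen) w.
  rewrite /word_eval (big_morph phi (aut_morph phi) (aut_1 phi)).
  by apply: eq_bigr => p _; apply: aut_expgz.
rewrite (logarithm_eval _ hpres hhom) (character_word_eval _ _ lM) /word_log.
by apply: eq_bigr => p _; rewrite hphi GRing.mul1r.
Qed.
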